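(* Let $\alpha,\beta,\mu,\nu>0$ be constants. Let $J_F, J_T, w \in L^1(\mathbb{R};\mathbb{R}^+)$ be kernels, each of which is an even function with integral over $\mathbb{R}$ equal to $1$. Let $\omega,\phi$ be the step functions $$\omega(x)=\begin{cases}\omega_0,& x\in[0,\theta_1),\\ \omega_1,& x\in[\theta_1,1],\end{cases}\qquad \phi(x)=\begin{cases}\phi_0,& x\in[0,\theta_2),\\ \phi_1,& x\in[\theta_2,1],\end{cases}$$ for some $\theta_1,\theta_2\in(0,1)$, $0<\omega_1<\omega_0$ and $0<\phi_0<\phi_1$. If $(\bar G,\bar S,\bar T,\bar F)$ is a (locally asymptotically) stable equilibrium of the nonspatial system $$\begin{aligned} \dot G &= \mu S+\nu T+\phi(G)F-\alpha GF-\beta GT,\\ \dot S &= -\mu S-\omega(G)S-\alpha SF+\beta GT,\\ \dot T &= -\nu T+\omega(G)S-\alpha TF,\\ \dot F &= \alpha(G+S+T)F-\phi(G)F,\\ 1 &= G+S+T+F, \end{aligned}$$ then it is also a stable spatially homogeneous equilibrium of the spatially extended system, posed for $(x,t)\in\mathbb{R}\times\mathbb{R}^+$, $$\begin{aligned} \partial_t G &= \mu S+\nu T+\phi(w*G)\,F-\alpha\, G\,(J_F*F)-\beta\, G\,(J_T*T),\\ \partial_t S &= -\mu S-\omega(w*G)\,S-\alpha\, S\,(J_F*F)+\beta\, G\,(J_T*T),\\ \partial_t T &= -\nu T+\omega(w*G)\,S-\alpha\, T\,(J_F*F),\\ \partial_t F &= \alpha\,(G+S+T)\,(J_F*F)-\phi(w*G)\,F,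 \end{aligned}$$ with $G(x,t)+S(x,t)+T(x,t)+F(x,t)=1$ for each $(x,t)$.
   Context: The unknowns $G,S,T,F$ are the proportions (in the spatial system, probability densities at location $x$) of grass, savanna saplings, savanna trees and forest trees. $(K*u)(x,t)=\int_{\mathbb{R}}K(x-y)u(y,t)\,dy$ denotes spatial convolution. Because the kernels have integral $1$, an equilibrium of the nonspatial system is also a spatially homogeneous (constant in $x$) solution of the spatial system. Local stability in the spatial system is assessed by linearization: one linearizes the spatial system about the homogeneous state, decomposes the perturbation into Fourier modes with wave number $\xi\in\mathbb{R}$, with amplitudes evolving as $e^{\lambda_\xi t}$, and considers the eigenvalues $\lambda_{i,\xi}$, $i=1,\dots,4$, of the resulting $4\times4$ problem for the amplitudes of $(G,S,T,F)$. The state is linearly unstable if $\Re(\lambda_{i,\xi})>0$ for some $i$ and some $\xi\neq0$. The step-function assumption implies $\phi'(x)=\omega'(x)=0$ for almost every $x\in(0,1)$. *)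

(* Defs.v *)
From HB Require Import structures.
From mathcomp Require Import all_boot all_order all_algebra.
From mathcomp Require Import complex.
From mathcomp Require Import all_classical all_reals all_analysis.

Set Implicit Arguments.
Unset Strict Implicit.
Unset Printing Implicit Defensive.

Import Order.TTheory GRing.Theory Num.Theory.
Import numFieldNormedType.Exports.

Local Open Scope classical_set_scope.
Local Open Scope ring_scope.

(* A state is a row vector (G, S, T, F). *)
Definition iG : 'I_4 := @Ordinal 4 0 isT.
Definition iS : 'I_4 := @Ordinal 4 1 isT.
Definition iT : 'I_4 := @Ordinal 4 2 isT.
Definition iF : 'I_4 := @Ordinal 4 3 isT.

Definition state (R : realType) (g s t f : R) : 'rV[R]_4 :=
  \row_(i < 4) nth 0 [:: g; s; t; f] i.

Definition proportions (R : realType) (u : 'rV[R]_4) : Prop :=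
  (forall i, 0 <= u ord0 i) /\
  u ord0 iG + u ord0 iS + u ord0 iT + u ord0 iF = 1.

(* Only values at x in [0, 1] matter; outside, the step function is continued
   by its end values. *)
Definition step (R : realType) (theta a b x : R) : R :=
  if x < theta then a else b.

Definition dispersal_kernel (R : realType) (J : R -> R) : Prop :=
  [/\ (@lebesgue_measure R).-integrable setT (EFin \o J),
      (forall x, 0 <= J x),
      (forall x, J (- x) = J x) &
      \int[@lebesgue_measure R]_(x in setT) J x = 1].

Definition convolution (R : realType) (K v : R -> R) (x : R) : R :=
  \int[@lebesgue_measure R]_(y in setT) (K (x - y) * v y).

Definition fourier (R : realType) (K : R -> R) (xi : R) : R[i] :=
  Complex (\int[@lebesgue_measure R]_(y in setT) (K y * cos (xi * y)))
          (- \int[@lebesgue_measure R]_(y in setT) (K y * sin (xi * y))).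

Definition toC (R : realType) (x : R) : R[i] := Complex x 0.

Section Model.
Variables (R : realType) (alpha beta mu nu : R) (omega phi : R -> R).

(* The right-hand side common to both systems: cF, cT, cG stand for F, T, G in
   the nonspatial system and for J_F * F, J_T * T, w * G in the spatial one. *)
Definition reaction (u : 'rV[R]_4) (cF cT cG : R) : 'rV[R]_4 :=
  let G := u ord0 iG in let S := u ord0 iS in
  let T := u ord0 iT in let F := u ord0 iF in
  state
    (mu * S + nu * T + phi cG * F - alpha * G * cF - beta * G * cT)
    (- mu * S - omega cG * S - alpha * S * cF + beta * G * cT)
    (- nu * T + omega cG * S - alpha * T * cF)
    (alpha * (G + S + T) * cF - phi cG * F).

Definition nonspatial_rhs (u : 'rV[R]_4) : 'rV[R]_4 :=
  reaction u (u ord0 iF) (u ord0 iT) (u ord0 iG).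

Definition nonspatial_equilibrium (u : 'rV[R]_4) : Prop :=
  proportions u /\ nonspatial_rhs u = 0.

Definition nonspatial_solution (z : R -> 'rV[R]_4) : Prop :=
  [/\ (forall t : R, 0 <= t -> proportions (z t)),
      {within `[0, +oo[, continuous z} &
      (forall t : R, 0 < t -> is_derive t 1 z (nonspatial_rhs (z t)))].

(* The solutions issued from nearby states are required to exist for all
   t >= 0.  When omega and phi are constant near the G-component of ubar this
   is no restriction: local solutions that stay close to ubar extend.  At a
   threshold the right-hand side is discontinuous and existence may fail. *)
Definition lyapunov_stable (ubar : 'rV[R]_4) : Prop :=
  forall eps : R, 0 < eps -> exists2 delta : R, 0 < delta &
    forall u0, proportions u0 -> `|u0 - ubar| < delta ->
      (exists z, nonspatial_solution z /\ z 0 = u0) /\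
      (forall z, nonspatial_solution z -> z 0 = u0 ->
         forall t : R, 0 <= t -> `|z t - ubar| < eps).

Definition locally_attractive (ubar : 'rV[R]_4) : Prop :=
  exists2 delta : R, 0 < delta &
    forall z, nonspatial_solution z -> `|z 0 - ubar| < delta ->
      z t @[t --> +oo] --> ubar.

Definition nonspatial_stable_equilibrium (ubar : 'rV[R]_4) : Prop :=
  [/\ nonspatial_equilibrium ubar, lyapunov_stable ubar &
      locally_attractive ubar].

Variables (JF JT w : R -> R).

Definition spatial_rhs (u : R -> 'rV[R]_4) (x : R) : 'rV[R]_4 :=
  reaction (u x) (convolution JF (fun y => u y ord0 iF) x)
                 (convolution JT (fun y => u y ord0 iT) x)
                 (convolution w (fun y => u y ord0 iG) x).

Definition spatial_equilibrium (u : R -> 'rV[R]_4) : Prop :=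
  forall x, proportions (u x) /\ spatial_rhs u x = 0.

(* Linearizing [spatial_rhs] at the constant state ubar and inserting the
   perturbation exp (i xi x) v(t), each convolution K * _ becomes
   multiplication by [fourier K xi], and the amplitudes (as a row vector) obey
   v' = v *m mode_matrix ubar xi; the (j, i) entry is the response of the i-th
   equation to the j-th amplitude.  The derivatives of omega and phi enter
   through the cG-derivative.  The library's derivative is total and has value
   0 at a jump, in accordance with omega' = phi' = 0 almost everywhere. *)
Definition mode_matrix (ubar : 'rV[R]_4) (xi : R) : 'M[R[i]]_4 :=
  let F := ubar ord0 iF in let T := ubar ord0 iT in let G := ubar ord0 iG in
  \matrix_(j < 4, i < 4)
    (toC ('D_(delta_mx ord0 j) (fun u => reaction u F T G ord0 i) ubar)
     + (j == iF)%:R * fourier JF xi *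
         toC (derive1 (fun c => reaction ubar c T G ord0 i) F)
     + (j == iT)%:R * fourier JT xi *
         toC (derive1 (fun c => reaction ubar F c G ord0 i) T)
     + (j == iG)%:R * fourier w xi *
         toC (derive1 (fun c => reaction ubar F T c ord0 i) G)).

Definition linearly_unstable (ubar : 'rV[R]_4) : Prop :=
  exists (xi : R) (lambda : R[i]),
    [/\ xi != 0, eigenvalue (mode_matrix ubar xi) lambda &
        0 < complex.Re lambda].

(* Every mode matrix has the eigenvalue 0, since the total G + S + T + F is
   conserved: stability cannot require all real parts to be negative. *)
Definition spatial_stable_homogeneous_equilibrium (ubar : 'rV[R]_4) : Prop :=
  spatial_equilibrium (fun=> ubar) /\ ~ linearly_unstable ubar.

End Model.

(* Main.v *)
(* Writing phi, omega for their values at G, the mode of wave number xi has,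
   besides 0, the eigenvalue alpha (1 - F) a - alpha F - phi of the forest
   component and, for amplitudes with f = 0 and g = - s - t, the eigenvalues of
   the block of (s, t), whose trace is negative and whose determinant is affine
   and nonincreasing in b; here a, b <= 1 are the (real) Fourier transforms of
   JF, JT at xi.  An unstable mode is thus unstable also for a = b = 1, i.e. for
   the nonspatial linearization.  There, the equilibrium equations exclude it
   unless F = 0, respectively S = T = 0; in these cases F, respectively S + q T
   for a suitable q > 1, would grow exponentially along nonspatial solutions
   near the equilibrium.  This holds also at a threshold, since below it phi is
   smaller and omega is larger. *)
Require Import Defs.
From mathcomp Require Import all_boot all_order all_algebra.
From mathcomp Require Import complex ring lra.
From mathcomp Require Import all_classical all_reals all_analysis measurable_realfun.

Set Implicit Arguments.
Unset Strict Implicit.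
Unset Printing Implicit Defensive.

Import Order.TTheory GRing.Theory Num.Theory.
Import numFieldNormedType.Exports.

Local Open Scope classical_set_scope.
Local Open Scope ring_scope.

Lemma big_ord4 (V : nmodType) (f : 'I_4 -> V) :
  \sum_j f j = f iG + f iS + f iT + f iF.
Proof.
rewrite !big_ord_recr big_ord0 /= add0r.
by congr (f _ + f _ + f _ + f _); apply: val_inj.
Qed.

Lemma ord4P (P : 'I_4 -> Prop) : P iG -> P iS -> P iT -> P iF -> forall i, P i.
Proof.
move=> PG PS PT PF [[|[|[|[|//]]]] lti].
- by rewrite (_ : Ordinal lti = iG) //; exact: val_inj.
- by rewrite (_ : Ordinal lti = iS) //; exact: val_inj.
- by rewrite (_ : Ordinal lti = iT) //; exact: val_inj.
- by rewrite (_ : Ordinal lti = iF) //; exact: val_inj.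
Qed.

(** * Convolution and Fourier transform of even probability kernels *)

Section Kernels.
Variable R : realType.
Local Notation mu := (@lebesgue_measure R).

(** The map [y => x - y] pulls []a, b]] back to an interval of the same length, so by uniqueness its
    pushforward of Lebesgue measure is Lebesgue measure. *)
Lemma Rintegral_reflection (f : R -> R) (x : R) :
  mu.-integrable setT (EFin \o f) ->
  \int[mu]_(y in setT) f (x - y) = \int[mu]_(y in setT) f y.
Proof.
move=> intf.
pose r : measurableTypeR R -> measurableTypeR R := fun y => x - y.
have mr : measurable_fun setT r by apply: continuous_measurable_fun => y; apply: cvgB; [exact: cvg_cst|exact: cvg_id].
have rr : (EFin \o f \o r) \o r = EFin \o f.
  by apply/funext => y /=; rewrite /r; congr (f _)%:E; ring.
have mf : measurable_fun setT (EFin \o f) by case/integrableP : intf.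
rewrite /Rintegral; congr fine.
have <- : (\int[pushforward mu r]_(y in setT) (EFin \o f \o r) y = \int[mu]_y (f y)%:E)%E.
  rewrite integral_pushforward ?preimage_setT ?rr //.
  exact: measurableT_comp.
apply: eq_measure_integral => A mA _; apply: lebesgue_measure_unique => //= _ [[a b]] _ <-.
rewrite /pushforward.
have -> : r @^-1` `]a, b]%classic = `[x - b, x - a[%classic.
  by apply/seteqP; split=> y /=; rewrite !in_itv/= /r; lra.
rewrite !lebesgue_measure_itv/= !lte_fin ltrD2l ltrN2.
by case: ifP => // _; rewrite -!EFinD; congr (_%:E); ring.
Qed.

Lemma convolution_cst (K : R -> R) (c x : R) :
  dispersal_kernel K -> convolution K (fun=> c) x = c.
Proof.
move=> [intK _ _ K1]; rewrite /convolution.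
rewrite (@Rintegral_reflection (fun y => K y * c) x).
  by rewrite RintegralZr // K1 mul1r.
have := integrableZr measurableT c intK.
by apply: eq_integrable.
Qed.

Lemma integrable_mul_bounded (K g : R -> R) :
  mu.-integrable setT (EFin \o K) -> continuous g -> (forall y, `|g y| <= 1) ->
  mu.-integrable setT (EFin \o (fun y => K y * g y)).
Proof.
move=> intK cg g1; apply: le_integrable (intK) => //.
  apply/measurable_EFinP; apply: measurable_funM.
    by apply/measurable_EFinP; case/integrableP : intK.
  exact: continuous_measurable_fun.
by move=> y _; rewrite lee_fin /= normrM ler_piMr.
Qed.

(** Evenness makes the sine integral its own negative, so the transform is real; [cos <= 1] and
    total mass 1 bound it by 1. *)
Lemma fourier_kernel (K : R -> R) (xi : R) :
  dispersal_kernel K -> exists2 k : R, fourier K xi = toC k & k <= 1.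
Proof.
move=> [intK K0 Keven K1].
have ctrig (h : R -> R) : continuous h -> continuous (fun y => h (xi * y)).
  move=> ch y; apply: continuous_comp; last exact: ch.
  by apply: cvgM; [exact: cvg_cst|exact: cvg_id].
have intc := integrable_mul_bounded intK (ctrig _ (@continuous_cos R)) (fun y => ltac:(by rewrite ler_norml cos_geN1 cos_le1)).
have ints := integrable_mul_bounded intK (ctrig _ (@continuous_sin R)) (fun y => ltac:(by rewrite ler_norml sin_geN1 sin_le1)).
exists (\int[mu]_(y in setT) (K y * cos (xi * y))).
  congr Complex.
  suff : \int[mu]_(y in setT) (K y * sin (xi * y)) = - \int[mu]_(y in setT) (K y * sin (xi * y)) by lra.
  rewrite -[in LHS](Rintegral_reflection 0 ints) -mulN1r -RintegralZl //.
  by apply: eq_Rintegral => y _; rewrite sub0r Keven mulrN sinN mulrN mulN1r.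
rewrite -K1; apply: le_Rintegral => // y _.
by rewrite ler_piMr // cos_le1.
Qed.
End Kernels.

(** * Derivatives of the reaction terms *)

Section Derivatives.
Variable R : realType.

(* A derivative from the right exists everywhere and is 0; where the two-sided
   one fails to exist, the library's value is the default point 0. *)
Lemma derive1_step (theta a b x : R) : derive1 (step theta a b) x = 0.
Proof.
set f := step theta a b; rewrite /derive1.
set q := fun h : R => h^-1 *: (f (h + x) - f x).
have q0 : q h @[h --> 0^'+] --> (0 : R).
  apply: cvg_near_cst; have [xt|xt] := ltP x theta.
    near=> h.
    have hx : h + x < theta.
      by rewrite -ltrBrDr; near: h; apply: nbhs_right_lt; rewrite subr_gt0.
    by rewrite /q /f /step hx xt subrr scaler0.
  near=> h; have h0 : 0 < h by near: h; exact: nbhs_right_gt.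
  have hx : (h + x < theta) = false by apply/negbTE; rewrite -leNgt; lra.
  by rewrite /q /f /step hx ltNge xt subrr scaler0.
case: (pselect (cvg (q h @[h --> 0^']))) => [cq|]; last exact: dvgP.
apply: (@cvg_unique _ (@norm_hausdorff _ R^o) (q h @[h --> 0^'+])) => //.
exact: cvg_dnbhs_at_right.
Unshelve. all: by end_near. Qed.

(** The difference quotient is constant off 0, so its limit is known without a separate proof of
    derivability. This covers every argument of [reaction] except [cG]. *)
Lemma derive_eq_diff (V : normedModType R) (f : V -> R) (u v : V) (k : R) :
  (forall h, f (h *: v + u) - f u = h * k) -> 'D_v f u = k.
Proof.
move=> fk; rewrite /derive; apply: lim_near_cst; first exact: norm_hausdorff.
near=> h; rewrite /= fk scalerA mulVf ?scale1r //.
by near: h; exact: nbhs_dnbhs_neq.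
Unshelve. all: by end_near. Qed.

Lemma derive1_eq_diff (f : R -> R) (x k : R) :
  (forall h, f (h + x) - f x = h * k) -> derive1 f x = k.
Proof.
move=> fk; rewrite derive1E; apply: derive_eq_diff => h.
by rewrite -[h *: 1]/(h * 1) mulr1 fk.
Qed.

Variables (alpha beta mu nu : R).
Variables (omega phi : R -> R).
Local Notation reaction := (reaction alpha beta mu nu omega phi).

Lemma derive_reaction (u v : 'rV[R]_4) (cF cT cG : R) (i : 'I_4) :
  'D_v (fun u => reaction u cF cT cG ord0 i) u = reaction v cF cT cG ord0 i.
Proof.
apply: derive_eq_diff => h; move: i; apply: ord4P; rewrite /Defs.reaction /state !mxE /=; ring.
Qed.

Lemma derive1_reactionF (u : 'rV[R]_4) (c cT cG : R) (i : 'I_4) :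
  derive1 (fun c => reaction u c cT cG ord0 i) c =
  state (- (alpha * u ord0 iG)) (- (alpha * u ord0 iS)) (- (alpha * u ord0 iT))
        (alpha * (u ord0 iG + u ord0 iS + u ord0 iT)) ord0 i.
Proof.
apply: derive1_eq_diff => h; move: i; apply: ord4P; rewrite /Defs.reaction /state !mxE /=; ring.
Qed.

Lemma derive1_reactionT (u : 'rV[R]_4) (cF c cG : R) (i : 'I_4) :
  derive1 (fun c => reaction u cF c cG ord0 i) c =
  state (- (beta * u ord0 iG)) (beta * u ord0 iG) 0 0 ord0 i.
Proof.
apply: derive1_eq_diff => h; move: i; apply: ord4P; rewrite /Defs.reaction /state !mxE /=; ring.
Qed.
End Derivatives.

(** The total derivative need not be additive at a jump. But each component involves only one of
    [omega] and [phi], hence is as a whole a step function of [c], and [derive1_step] applies. *)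
Lemma derive1_reaction_step (R : realType) (alpha beta mu nu : R)
    (theta1 a1 b1 theta2 a2 b2 : R) (u : 'rV[R]_4) (cF cT c : R) (i : 'I_4) :
  derive1 (fun c => reaction alpha beta mu nu (step theta1 a1 b1) (step theta2 a2 b2) u cF cT c ord0 i) c = 0.
Proof.
set f := fun c => _.
suff [theta [a [b ->]]] : exists theta a b, f = step theta a b by exact: derive1_step.
pose g a b := reaction alpha beta mu nu (fun=> a) (fun=> b) u cF cT 0 ord0 i.
rewrite /f /Defs.reaction; move: i @f @g; apply: ord4P => f g.
- exists theta2, (g a1 a2), (g a1 b2); apply/funext => x.
  by rewrite /f /g /step /state !mxE /=; case: ifP.
- exists theta1, (g a1 a2), (g b1 a2); apply/funext => x.
  by rewrite /f /g /step /state !mxE /=; case: ifP.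
- exists theta1, (g a1 a2), (g b1 a2); apply/funext => x.
  by rewrite /f /g /step /state !mxE /=; case: ifP.
- exists theta2, (g a1 a2), (g a1 b2); apply/funext => x.
  by rewrite /f /g /step /state !mxE /=; case: ifP.
Qed.

(** * Eigenvalues of the Fourier modes *)

Section Mode.
Variables (R : realType) (alpha beta mu nu : R).
Variables (theta1 omega0 omega1 theta2 phi0 phi1 : R) (JF JT w : R -> R).
Local Notation omega := (step theta1 omega0 omega1).
Local Notation phi := (step theta2 phi0 phi1).
Local Notation c := (real_complex R).

Lemma mode_mulE (u : 'rV[R]_4) (xi a b : R) (v : 'rV[R[i]]_4) :
  fourier JF xi = toC a -> fourier JT xi = toC b ->
  let G := u ord0 iG in let S := u ord0 iS in
  let T := u ord0 iT in let F := u ord0 iF in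
  let g := v ord0 iG in let s := v ord0 iS in
  let t := v ord0 iT in let f := v ord0 iF in
  v *m mode_matrix alpha beta mu nu omega phi JF JT w u xi =
  \row_i nth 0 [::
    c mu * s + c nu * t + c (phi G) * f
      - c (alpha * F) * g - c (alpha * G * a) * f - c (beta * T) * g - c (beta * G * b) * t;
    - c mu * s - c (omega G) * s - c (alpha * F) * s - c (alpha * S * a) * f
      + c (beta * T) * g + c (beta * G * b) * t;
    - c nu * t + c (omega G) * s - c (alpha * F) * t - c (alpha * T * a) * f;
    c (alpha * F) * (g + s + t) + c (alpha * (G + S + T) * a) * f - c (phi G) * f] i.
Proof.
move=> Fa Tb G S T F g s t f; apply/rowP; apply: ord4P; rewrite !mxE /= big_ord4 !mxE Fa Tb.
all: rewrite !derive_reaction !derive1_reactionF !derive1_reactionT !derive1_reaction_step.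
all: rewrite /reaction /state !mxE /= -/G -/S -/T -/F -/g -/s -/t -/f.
all: rewrite -![toC _]/(c _); ring.
Qed.

(** Adding the four equations gives [lambda * (g + s + t + f) = 0], so [g = - (s + t + f)]. For
    [f != 0] the forest equation then yields [lambda]; for [f = 0] the pair [(s, t)] solves a 2 by 2
    problem whose characteristic equation is the second alternative. *)
Lemma mode_eigenvalue (u : 'rV[R]_4) (xi a b : R) (lambda : R[i]) :
  fourier JF xi = toC a -> fourier JT xi = toC b ->
  let G := u ord0 iG in let S := u ord0 iS in
  let T := u ord0 iT in let F := u ord0 iF in
  omega G != 0 -> lambda != 0 ->
  eigenvalue (mode_matrix alpha beta mu nu omega phi JF JT w u xi) lambda ->
  lambda = c (alpha * (G + S + T) * a - alpha * F - phi G) \/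
  (lambda + c (mu + omega G + alpha * F + beta * T)) * (lambda + c (nu + alpha * F)) =
    c (omega G * (beta * G * b - beta * T)).
Proof.
move=> Fa Tb G S T F om0 lam0 /eigenvalueP[v vM v0].
pose g := v ord0 iG; pose s := v ord0 iS; pose t := v ord0 iT; pose f := v ord0 iF.
move: vM; rewrite (mode_mulE _ _ Fa Tb) -/G -/S -/T -/F -/g -/s -/t -/f => /rowP vM.
have := vM iF; have := vM iT; have := vM iS; have := vM iG.
rewrite !mxE /= -/g -/s -/t -/f => eG eS eT eF {vM}.
have om0' : c (omega G) != 0 by rewrite fmorph_eq0.
have sum0 : g + s + t + f = 0.
  apply: (mulfI lam0); rewrite mulr0 !mulrDr -eG -eS -eT -eF; ring.
have gE : g = - (s + t + f).
  by apply/eqP; rewrite -addr_eq0 -sum0; apply/eqP; ring.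
have [f0|f0] := eqVneq f 0; [right|left]; last first.
  by apply: (mulIf f0); rewrite -eF gE; ring.
have tE : (lambda + c (nu + alpha * F)) * t = c (omega G) * s.
  rewrite mulrDl -eT f0; ring.
have sE : (lambda + c (mu + omega G + alpha * F + beta * T)) * s = c (beta * G * b - beta * T) * t.
  rewrite mulrDl -eS f0 gE f0; ring.
(* [t = 0] would force [s = 0], as [omega G != 0], and then the whole eigenvector vanishes. *)
have t0 : t != 0.
  apply: contra_neq v0 => t0; have /eqP := tE.
  rewrite t0 mulr0 eq_sym mulf_eq0 (negPf om0') /= => /eqP s0.
  apply/rowP; apply: ord4P; rewrite !mxE -/g -/s -/t -/f ?gE ?f0 ?t0 ?s0 //; ring.
apply: (mulIf t0).
by rewrite -[LHS]mulrA tE mulrCA sE; ring.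
Qed.
End Mode.

(** If the real part [x] were positive, the imaginary part [y * (2 * x + A + n) = 0] of the equation
    would give [y = 0]; then [q = (x + A) * (x + n)] would exceed [A * n]. *)
Lemma Re_quadratic_le0 (R : realType) (lambda : R[i]) (A n q : R) :
  0 < A -> 0 < n -> q <= A * n ->
  (lambda + real_complex R A) * (lambda + real_complex R n) = real_complex R q ->
  complex.Re lambda <= 0.
Proof.
case: lambda => x y A0 n0 qAn [] /= eRe eIm; rewrite leNgt; apply/negP => x0.
have y0 : y = 0.
  have /eqP : y * (2 * x + A + n) = 0 by lra.
  by rewrite mulf_eq0 => /orP[/eqP //|/eqP]; lra.
by rewrite y0 in eRe; nra.
Qed.

(** * Instability from an exponentially growing linear functional *)

(** [V t * expR (- c * t)] is nondecreasing, hence [V t >= V 0 * expR (c * t)]. *)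
Lemma growth_unbounded (R : realType) (V : R -> R) (c B : R) :
  0 < c -> 0 < V 0 -> {within `[0, +oo[, continuous V} ->
  (forall t, 0 < t -> derivable V t 1 /\ c * V t <= derive1 V t) ->
  ~ (forall t, 0 <= t -> V t <= B).
Proof.
move=> c0 V0 cV dV VB.
pose E : R -> R := fun t => expR (- c * t).
have dE (t : R) : is_derive t (1 : R) E (- c * E t).
  have dl : is_derive t (1 : R) ( *%R (- c)) (- c).
    by apply: is_derive_eq (is_deriveZ (- c) (is_derive_id t (1 : R))) _; exact: mulr1.
  rewrite mulrC; exact: is_derive1_comp (is_derive_expR _) dl.
have B0 : 0 < B by apply: lt_le_trans V0 (VB _ _).
(* At this time [V 0 * (1 + c * t) = V 0 + B], which already exceeds [B]. *)
pose t := B / (c * V 0).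
have t0 : 0 < t by rewrite divr_gt0 // mulr_gt0.
have mono : V 0 * E 0 <= V t * E t.
  have dW x : x \in `]0, t[ -> is_derive x 1 (V * E) (V x * (- c * E x) + E x * derive1 V x).
    rewrite in_itv /= => /andP[x0 _].
    have [dVx _] := dV x x0.
    have dVx' : is_derive x 1 V (derive1 V x) by rewrite derive1E; exact/derivableP.
    exact: is_deriveM.
  apply: (@ger0_derive1_le_cc R (V * E) 0 t); rewrite ?bound_itvE ?(ltW t0) //.
  - by move=> x /dW [].
  - move=> x xt; rewrite derive1E (@derive_val _ _ _ _ _ _ _ (dW x xt)).
    move: xt; rewrite in_itv /= => /andP[x0 _].
    have [_ cVx] := dV x x0; have E0 : 0 < E x by exact: expR_gt0.
    by rewrite (_ : _ + _ = E x * (derive1 V x - c * V x)) ?mulr_ge0 ?subr_ge0 ?(ltW E0) //; ring.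
  - have -> : V * E = V \* E by [].
    move=> x; apply: cvgM; first by apply: (continuous_subspaceW _ cV); apply: subset_itvl.
    apply: continuous_subspaceT => y; apply: differentiable_continuous; apply/derivable1_diffP; exact: ex_derive.
have Et : E t * expR (c * t) = 1 by rewrite /E -expRD mulNr addNr expR0.
have E0 : E 0 = 1 by rewrite /E mulr0 expR0.
have VtB := VB t (ltW t0).
have e1 := expR_ge1Dx (c * t).
have ctV : c * t * V 0 = B by rewrite /t; field; rewrite !gt_eqF.
have : V 0 * (1 + c * t) <= V t.
  apply: (@le_trans _ _ (V 0 * expR (c * t))); first by rewrite ler_pM2l.
  rewrite -[leRHS]mulr1 -Et mulrA ler_pM2r ?expR_gt0 //; move: mono; rewrite E0 mulr1; lra.
rewrite mulrDr mulr1 [V 0 * _]mulrC ctV; lra.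
Qed.

(** By right-continuity a nearby value can differ only by being the left value [a]. For [phi] that
    value is the smaller one and for [omega] the larger one, which only favours growth in the
    instability arguments. *)
Lemma step_near (R : realType) (theta a b x0 : R) :
  exists2 e : R, 0 < e & forall x, `|x - x0| < e ->
    step theta a b x = step theta a b x0 \/
    step theta a b x = a /\ step theta a b x0 = b.
Proof.
rewrite /step; case: (ltP x0 theta) => [x0t|_].
  exists (theta - x0); first by rewrite subr_gt0.
  move=> x /ltr_normlP[_ xx0]; left.
  by rewrite ifT //; lra.
by exists 1 => // x _; case: ifP; [right|left].
Qed.

Lemma normr_entry_le (R : realType) (m n : nat) (u : 'M[R]_(m, n)) i j :
  `|u i j| <= `|u|.
Proof.
rewrite [leRHS]/Num.Def.normr /= mx_normrE.
exact: (le_bigmax _ (fun ij => `|u ij.1 ij.2|) (i, j)).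
Qed.

Section Instability.
Variables (R : realType) (alpha beta mu nu : R) (omega phi : R -> R).
Local Notation rhs := (nonspatial_rhs alpha beta mu nu omega phi).

Lemma proportions_le1 (u : 'rV[R]_4) i : proportions u -> 0 <= u ord0 i <= 1.
Proof.
move=> [u0 u1]; rewrite u0 -u1; move: i; apply: ord4P;
  have := u0 iG; have := u0 iS; have := u0 iT; have := u0 iF; lra.
Qed.

Lemma proportions_segment (u v : 'rV[R]_4) (r : R) :
  proportions u -> proportions v -> 0 <= r <= 1 ->
  proportions (u + r *: (v - u)).
Proof.
move=> [u0 u1] [v0 v1] r01; split=> [i|]; rewrite !mxE; last first.
  transitivity ((1 - r) * (u ord0 iG + u ord0 iS + u ord0 iT + u ord0 iF) +
    r * (v ord0 iG + v ord0 iS + v ord0 iT + v ord0 iF)); first by ring.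
  by rewrite u1 v1; ring.
by have := u0 i; have := v0 i; nra.
Qed.

(* The initial states are taken on the segment from ubar to e; along solutions
   from there V grows exponentially as long as they stay near ubar. *)
Lemma unstable_functional (ubar e : 'rV[R]_4) (p : 'I_4 -> R) (eps c : R) :
  let V (u : 'rV[R]_4) := \sum_i p i * u ord0 i in
  0 < eps -> 0 < c -> proportions ubar -> proportions e ->
  0 <= V ubar -> 0 < V e ->
  (forall u, proportions u -> `|u - ubar| < eps -> c * V u <= V (rhs u)) ->
  ~ lyapunov_stable alpha beta mu nu omega phi ubar.
Proof.
move=> V eps0 c0 pu pe Vu Ve Vgrow /(_ _ eps0)[delta delta0 stab].
(* The bound 1 keeps [u0] on the segment, the other one makes [r] times the norm of [e - ubar] less
   than [delta]; the summand 1 keeps the denominator positive when [e = ubar]. *)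
pose r := Num.min 1 (delta / (2 * (1 + `|e - ubar|))).
have n0 : 0 <= `|e - ubar| by [].
have r0 : 0 < r by rewrite lt_min ltr01 divr_gt0 // mulr_gt0 //; lra.
have r1 : r <= 1 by rewrite ge_min lexx.
pose u0 := ubar + r *: (e - ubar).
have pu0 : proportions u0 by apply: proportions_segment => //; rewrite r1 ltW.
have u0d : `|u0 - ubar| < delta.
  rewrite addrC addKr normrZ gtr0_norm //.
  have : r * (2 * (1 + `|e - ubar|)) <= delta.
    by rewrite -ler_pdivlMr ?ge_min ?lexx ?orbT //; lra.
  nra.
have [[z [zsol z0]] close] := stab u0 pu0 u0d.
have {}close := close z zsol z0.
have [zp zc zd] := zsol.
have Vlin : V u0 = (1 - r) * V ubar + r * V e.
  rewrite /V !mulr_sumr -big_split /=; apply: eq_bigr => i _.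
  by rewrite !mxE; ring.
(* Growth contradicts boundedness: all entries of [z t] lie in [[0, 1]], so [V] is at most the sum
   of the absolute values of the weights [p i]. *)
apply: (@growth_unbounded R (V \o z) c (\sum_i `|p i|)) => //=.
- rewrite z0 Vlin; nra.
- apply: within_continuous_comp zc => u _.
  have -> : V = fun u => p iG * u ord0 iG + p iS * u ord0 iS + p iT * u ord0 iT + p iF * u ord0 iF.
    by apply/funext => x; exact: big_ord4.
  have cvg_term i : p i * x ord0 i @[x --> u] --> p i * u ord0 i.
    by apply: cvgM; [exact: cvg_cst|exact: coord_continuous].
  exact: cvgD (cvgD (cvgD (cvg_term _) (cvg_term _)) (cvg_term _)) (cvg_term _).
- move=> t t0; have dz := zd t t0.
  have dzi i : is_derive t 1 (fun t => z t ord0 i) (rhs (z t) ord0 i).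
    apply: DeriveDef; first by move/derivable_mxP : (@ex_derive _ _ _ _ _ _ _ dz).
    by rewrite -(derive_val (is_derive := dz)) derive_mx ?mxE //; exact: ex_derive.
  have dV : is_derive t 1 (V \o z) (V (rhs (z t))).
    have -> : V \o z = \sum_i (p i \*: (fun t => z t ord0 i)).
      by apply/funext => x; rewrite fct_sumE.
    by apply: is_derive_sum.
  split; first exact: ex_derive.
  rewrite derive1E derive_val; apply: Vgrow; [apply: zp|apply: close]; exact: ltW.
- move=> t t0; apply: ler_sum => i _; apply: le_trans (ler_norm _) _.
  have /andP[zi0 zi1] := proportions_le1 i (zp t t0).
  by rewrite normrM ler_piMr // ger0_norm.
Qed.
End Instability.

Lemma entry_near_min (R : realType) (u v : 'rV[R]_4) (d e : R) i :
  `|u - v| < Num.min d e ->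
  `|u ord0 i - v ord0 i| < d /\ `|u ord0 i - v ord0 i| < e.
Proof.
rewrite lt_min => /andP[ud ue].
have := normr_entry_le (u - v) ord0 i; rewrite !mxE => le_uv.
by split; exact: le_lt_trans le_uv _.
Qed.

(** * Consequences of nonspatial stability for the linearization *)

Section Stability.
Variables (R : realType) (alpha beta mu nu : R).
Variables (omega0 omega1 theta1 phi0 phi1 theta2 : R) (ubar : 'rV[R]_4).
Local Notation omega := (step theta1 omega0 omega1).
Local Notation phi := (step theta2 phi0 phi1).
Local Notation G := (ubar ord0 iG).
Local Notation S := (ubar ord0 iS).
Local Notation T := (ubar ord0 iT).
Local Notation F := (ubar ord0 iF).
Local Notation equilibrium :=
  (nonspatial_equilibrium alpha beta mu nu omega phi ubar).
Local Notation stable := (lyapunov_stable alpha beta mu nu omega phi ubar).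

Lemma equilibriumE : equilibrium ->
  [/\ [/\ 0 <= G, 0 <= S, 0 <= T & 0 <= F], G + S + T + F = 1,
      - mu * S - omega G * S - alpha * S * F + beta * G * T = 0,
      - nu * T + omega G * S - alpha * T * F = 0 &
      alpha * (G + S + T) * F - phi G * F = 0].
Proof.
move=> [[u0 u1] /rowP rhs0]; split=> //.
- by have := rhs0 iS; rewrite /nonspatial_rhs /reaction /state !mxE.
- by have := rhs0 iT; rewrite /nonspatial_rhs /reaction /state !mxE.
- by have := rhs0 iF; rewrite /nonspatial_rhs /reaction /state !mxE.
Qed.

Lemma omega_gt0 x : 0 < omega1 < omega0 -> 0 < omega x.
Proof. move=> /andP[? ?]; rewrite /step; case: ifP; lra. Qed.

Lemma proportions_delta i : proportions (delta_mx ord0 i : 'rV[R]_4).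
Proof.
split; first by move=> j; rewrite !mxE /=; case: eqP.
by rewrite -(big_ord4 (fun j => (delta_mx ord0 i : 'rV[R]_4) ord0 j))
  (bigD1 i) //= big1 ?mxE ?eqxx ?addr0 // => j /negPf ji; rewrite mxE ji andbF.
Qed.

(** If [alpha > phi G], rare forest invades: near [ubar] the relative growth rate of the forest
    component is at least [c], half of [alpha - phi G], because [eps] keeps [alpha] times that
    component below [c]. *)
Lemma forest_invasion_le0 : 0 < alpha -> 0 < phi0 < phi1 ->
  equilibrium -> stable -> F = 0 -> alpha <= phi G.
Proof.
move=> alpha_gt0 phi_lt [pu _] stab F0; rewrite leNgt; apply/negP => lt_phi; move: stab.
pose c := (alpha - phi G) / 2; have c0 : 0 < c by rewrite /c; lra.
have [e e0 phi_near] := step_near theta2 phi0 phi1 G.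
pose eps := Num.min e (c / alpha).
have VE u : \sum_i (i == iF)%:R * u ord0 i = u ord0 iF :> R.
  by rewrite big_ord4 /=; ring.
apply: (@unstable_functional _ _ _ _ _ _ _ _ (delta_mx ord0 iF) (fun i => (i == iF)%:R) eps c);
  rewrite ?VE ?F0 ?mxE ?lexx ?ltr01 //.
- by rewrite lt_min e0 divr_gt0.
- exact: proportions_delta.
move=> u pu' u_near; rewrite !VE.
have [_ u1] := pu'; have /andP[uF0 _] := proportions_le1 iF pu'.
have [/phi_near phi_u _] := entry_near_min iG u_near.
have [_] := entry_near_min iF u_near.
rewrite F0 subr0 ger0_norm // ltr_pdivlMr // => uF_lt.
have phi_le : phi (u ord0 iG) <= phi G.
  by have /andP[_ ?] := phi_lt; case: phi_u => [-> //|[-> ->]]; exact: ltW.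
rewrite /nonspatial_rhs /reaction /state !mxE /= -subr_ge0.
set uF := u ord0 iF in uF0 uF_lt *.
have -> : u ord0 iG + u ord0 iS + u ord0 iT = 1 - uF by rewrite -u1 /uF; ring.
rewrite [X in 0 <= X](_ : _ = uF * (alpha - uF * alpha - phi (u ord0 iG) - c)); last by ring.
by rewrite mulr_ge0 //; rewrite /c in uF_lt *; lra.
Qed.

(* Only T = S = 0 needs stability: if T > 0 the equilibrium equations give
   determinant beta T (nu + alpha F + omega) > 0. *)
Lemma savanna_det_ge0 :
  0 < alpha -> 0 < beta -> 0 < mu -> 0 < nu -> 0 < omega1 < omega0 ->
  equilibrium -> stable ->
  omega G * (beta * G - beta * T) <=
  (mu + omega G + alpha * F + beta * T) * (nu + alpha * F).
Proof.
move=> alpha_gt0 beta_gt0 mu_gt0 nu_gt0 omega_lt eq_ubar stab.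
have [[G0 S0 T0 F0] sum1 eS eT eF] := equilibriumE eq_ubar.
have om0 := omega_gt0 G omega_lt.
have [Tpos|] := ltP 0 T.
  (* Eliminating [S] between the two savanna equations shows that, for [T > 0], the determinant
     without its [beta * T] terms is 0. *)
  have e1 : T * ((mu + omega G + alpha * F) * (nu + alpha * F) - omega G * (beta * G)) = 0.
    transitivity (
      - omega G * (- mu * S - omega G * S - alpha * S * F + beta * G * T) -
      (mu + omega G + alpha * F) * (- nu * T + omega G * S - alpha * T * F)).
      ring.
    by rewrite eS eT; ring.
  have {}e1 : (mu + omega G + alpha * F) * (nu + alpha * F) - omega G * (beta * G) = 0.
    by move/eqP: e1; rewrite mulf_eq0 gt_eqF //= => /eqP.
  have aF : 0 <= alpha * F by rewrite mulr_ge0 // ltW.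
  have bT : 0 <= beta * T by rewrite mulr_ge0 // ltW.
  rewrite -subr_ge0 [X in 0 <= X](_ : _ = beta * T * (nu + alpha * F + omega G)); last first.
    by rewrite -[RHS]addr0 -e1; ring.
  by rewrite mulr_ge0 //; lra.
move=> Tle0; have {Tle0}T00 : T = 0 by lra.
have S00 : S = 0.
  have /eqP : omega G * S = 0 by move: eT; rewrite T00; lra.
  by rewrite mulf_eq0 gt_eqF //= => /eqP.
rewrite T00 mulr0 subr0 addr0 leNgt; apply/negP => det_lt0; move: stab.
have [pu _] := eq_ubar.
pose m := mu + alpha * F; pose n := nu + alpha * F.
have aF : 0 <= alpha * F by rewrite mulr_ge0 // ltW.
have m0 : 0 < m by rewrite /m; lra.
have n0 : 0 < n by rewrite /n; lra.
(* In the derivative of [S + q * T], the coefficients of [S] and [T] at [ubar] are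
   [omega G * (q - 1) - m] and [beta * G - q * n]. Both are positive exactly for [q] between these
   two bounds; the negative determinant separates them, and [q] is the midpoint. *)
have q_lt : (omega G + m) / omega G < beta * G / n.
  by rewrite ltr_pdivrMr // mulrAC ltr_pdivlMr //; rewrite /m /n; lra.
pose q := ((omega G + m) / omega G + beta * G / n) / 2.
have q1 : 0 < omega G * (q - 1) - m.
  have : (omega G + m) / omega G < q by rewrite /q; lra.
  by rewrite ltr_pdivrMr //; lra.
have q2 : 0 < beta * G - q * n.
  have : q < beta * G / n by rewrite /q; lra.
  by rewrite ltr_pdivlMr //; lra.
have q_gt1 : 1 < q.
  rewrite -subr_gt0 -(pmulr_rgt0 _ om0); lra.
pose k := Num.min (omega G * (q - 1) - m) (beta * G - q * n).
have k0 : 0 < k by rewrite lt_min q1 q2.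
(* Half of the margin [k] pays for the growth rate, as [c <= c * q = k / 2]; the other half pays for
   the deviation from [ubar], which [eps] limits. *)
pose c := k / (2 * q).
have [e e0 omega_near] := step_near theta1 omega0 omega1 G.
pose eps := Num.min e (k / (2 * (alpha + beta + q * alpha))).
pose p (i : 'I_4) : R := (i == iS)%:R + q * (i == iT)%:R.
have VE u : \sum_i p i * u ord0 i = u ord0 iS + q * u ord0 iT :> R.
  by rewrite big_ord4 /p /=; ring.
apply: (@unstable_functional _ _ _ _ _ _ _ _ (delta_mx ord0 iS) p eps c);
  rewrite ?VE ?S00 ?T00 ?mxE //.
- by rewrite lt_min e0 divr_gt0 // mulr_gt0 //; have := mulr_gt0 (lt_trans ltr01 q_gt1) alpha_gt0; lra.
- by rewrite divr_gt0 // mulr_gt0 //; lra.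
- exact: proportions_delta.
- lra.
- by rewrite /= mulr0 addr0 ltr01.
move=> u pu' u_near; rewrite !VE.
have /andP[uS0 _] := proportions_le1 iS pu'; have /andP[uT0 _] := proportions_le1 iT pu'.
have [/omega_near omega_u /ltr_normlP[uG1 uG2]] := entry_near_min iG u_near.
have [_ /ltr_normlP[uF1 uF2]] := entry_near_min iF u_near.
have omega_le : omega G <= omega (u ord0 iG).
  by have /andP[_ ?] := omega_lt; case: omega_u => [-> //|[-> ->]]; exact: ltW.
move: uG1 uG2 uF1 uF2; set d := k / _ => uG1 uG2 uF1 uF2.
have dE : (alpha + beta + q * alpha) * d = k / 2.
  have qa := mulr_gt0 (lt_trans ltr01 q_gt1) alpha_gt0.
  by rewrite /d; field; apply/eqP; lra.
have cqE : c * q = k / 2 by rewrite /c; field; apply/eqP; lra.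
have d0 : 0 <= d by rewrite /d divr_ge0 ?(ltW k0) // mulr_ge0 //; have := mulr_gt0 (lt_trans ltr01 q_gt1) alpha_gt0; lra.
have cq : c <= k / 2.
  by rewrite -cqE; apply: ler_peMr; [rewrite /c divr_ge0 ?(ltW k0) //; lra|exact: ltW].
have [k1 k2] : k <= omega G * (q - 1) - m /\ k <= beta * G - q * n.
  by split; rewrite ge_min lexx ?orbT.
rewrite /nonspatial_rhs /reaction /state !mxE /= -subr_ge0.
set uS := u ord0 iS in uS0 *; set uT := u ord0 iT in uT0 *.
set uG := u ord0 iG in uG1 uG2 omega_le *; set uF := u ord0 iF in uF1 uF2 *.
rewrite [X in 0 <= X](_ : _ =
  uS * (omega uG * (q - 1) - mu - alpha * uF - c) +
  uT * (beta * uG - q * (nu + alpha * uF) - c * q)); last by ring.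
have qa := mulr_gt0 (lt_trans ltr01 q_gt1) alpha_gt0.
have aF_le : alpha * uF <= alpha * F + alpha * d by rewrite -mulrDr ler_pM2l //; lra.
have qaF_le : q * alpha * uF <= q * alpha * F + q * alpha * d by rewrite -mulrDr ler_pM2l //; lra.
have bG_le : beta * G - beta * d <= beta * uG by rewrite -mulrBr ler_pM2l //; lra.
have om_le : omega G * (q - 1) <= omega uG * (q - 1) by rewrite ler_wpM2r //; lra.
have ad0 : 0 <= alpha * d by rewrite mulr_ge0 // ltW.
have bd0 : 0 <= beta * d by rewrite mulr_ge0 // ltW.
have qad0 : 0 <= q * alpha * d by rewrite mulr_ge0 // ltW.
rewrite /m in k1; rewrite /n in k2.
rewrite addr_ge0 // mulr_ge0 //; lra.
Qed.
End Stability.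

Theorem proposition1 (R : realType) (alpha beta mu nu : R)
    (alpha_gt0 : 0 < alpha) (beta_gt0 : 0 < beta)
    (mu_gt0 : 0 < mu) (nu_gt0 : 0 < nu)
    (JF JT w : R -> R)
    (JF_kernel : dispersal_kernel JF) (JT_kernel : dispersal_kernel JT) (w_kernel : dispersal_kernel w)
    (omega0 omega1 theta1 phi0 phi1 theta2 : R)
    (theta1_in : 0 < theta1 < 1) (theta2_in : 0 < theta2 < 1)
    (omega_lt : 0 < omega1 < omega0) (phi_lt : 0 < phi0 < phi1)
    (ubar : 'rV[R]_4) :
  let omega := step theta1 omega0 omega1 in
  let phi := step theta2 phi0 phi1 in
  nonspatial_stable_equilibrium alpha beta mu nu omega phi ubar ->
  spatial_stable_homogeneous_equilibrium alpha beta mu nu omega phi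
    JF JT w ubar.
Proof.
move=> omega phi [eq_ubar stab _]; split=> [x|].
  by case: eq_ubar => pu rhs0; split=> //; rewrite /spatial_rhs !convolution_cst.
move=> [xi [lambda [_ ev Re_gt0]]].
have [a Fa a1] := fourier_kernel xi JF_kernel.
have [b Fb b1] := fourier_kernel xi JT_kernel.
have [[G0 S0 T0 F0] sum1 _ _ eF] := equilibriumE eq_ubar.
have om0 : 0 < omega (ubar ord0 iG) := omega_gt0 _ _ omega_lt.
have lam0 : lambda != 0 by apply: contraTneq Re_gt0 => ->; rewrite ltxx.
move: Re_gt0; case: (mode_eigenvalue Fa Fb (lt0r_neq0 om0) lam0 ev) => [->|quad] /=.
(* Forest eigenvalue: [a <= 1] reduces to the nonspatial value. For [F > 0] the equilibrium equation
   leaves at most [- alpha * F]; for [F = 0] the invasion bound [alpha <= phi G] applies. *)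
- have GST : 0 <= alpha * (ubar ord0 iG + ubar ord0 iS + ubar ord0 iT).
    by rewrite mulr_ge0 ?(ltW alpha_gt0) // !addr_ge0.
  have GSTa := ler_piMr GST a1.
  have [Fpos|Fle0] := ltP 0 (ubar ord0 iF).
    have {}eF : alpha * (ubar ord0 iG + ubar ord0 iS + ubar ord0 iT) = phi (ubar ord0 iG).
      by apply: (mulIf (lt0r_neq0 Fpos)); apply/eqP; rewrite -subr_eq0 eF.
    have := mulr_gt0 alpha_gt0 Fpos.
    by rewrite eF in GSTa *; rewrite -/phi; lra.
  have {Fle0}F00 : ubar ord0 iF = 0 by lra.
  have := forest_invasion_le0 alpha_gt0 phi_lt eq_ubar stab F00.
  move: sum1 GSTa; rewrite F00 addr0 -/phi => -> /=; rewrite mulr1; lra.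
apply/negP; rewrite -leNgt.
have aF : 0 <= alpha * ubar ord0 iF by rewrite mulr_ge0 // ltW.
have bT : 0 <= beta * ubar ord0 iT by rewrite mulr_ge0 // ltW.
apply: Re_quadratic_le0 quad; rewrite -/omega; try lra.
(* Since [beta * G >= 0] and [b <= 1], the determinant is smallest at [b = 1], the nonspatial
   case. *)
apply: le_trans (savanna_det_ge0 alpha_gt0 beta_gt0 mu_gt0 nu_gt0 omega_lt eq_ubar stab).
rewrite -/omega ler_pM2l // lerD2r; apply: ler_piMr b1.
by rewrite mulr_ge0 // ltW.
Qed.
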